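(* Let $n\ge 2$ and consider an $n$-player game with cost functions $J_i:\mathbb{R}^n\to\mathbb{R}$ and action sets $\Omega_i=\mathbb{R}$, $i\in[n]$, where each $J_i(x_i,x_{-i})$ is continuously differentiable in $x_i$ for each fixed $x_{-i}$, together with an undirected communication graph $\mathcal{G}([n],\mathcal{A})$. Assume: (1) the game mapping $\mathbf{F}(x)=[\nabla_1J_1(x),\ldots,\nabla_nJ_n(x)]^T$ is strongly monotone on $\mathbb{R}^n$ with constant $\mu>0$, i.e. $\langle \mathbf{F}(x)-\mathbf{F}(y),x-y\rangle\ge\mu\|x-y\|^2$ for all $x,y\in\mathbb{R}^n$; (2) for each $i\in[n]$ there is a constant $L_i\ge 0$ with $|\nabla_iJ_i(x)-\nabla_iJ_i(y)|\le L_i\|x-y\|$ for all $x,y\in\mathbb{R}^n$; put $L=\max_{i\in[n]}L_i$; (3) the graph $\mathcal{G}([n],\mathcal{A})$ is connected, and $W=[w_{ij}]\in\mathbb{R}^{n\times n}$ is a non-negative doubly stochastic matrix such that $w_{ij}>0$ if and only if $(i,j)\in\mathcal{A}$; the second largest singular value $\sigma$ of $W$ satisfies $\sigma\in(0,1)$. Let the step size $\alpha$ satisfy $$0<\alpha<\min\left\{1,\ \frac{\mu}{2L^2},\ \frac{\sigma}{2L}\frac{\sqrt n}{\sqrt{n-1}}\left(\frac{\sqrt2}{\sqrt{1+\sigma^2}}-1\right),\ \frac{n}{\mu}\left(\frac{8}{(\sqrt{1+\sigma^2}-\sqrt2)^2}-1\right),\ \frac{\sqrt{n^2+\frac{2\mu^4(1-\sigma^2)}{(n-1)L^4(1+\sigma^2)}}-n}{2\mu}\right\}.$$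 Let $\mathbf{x}^*\in\mathbb{R}^{n\times n}$ be the matrix all of whose rows are equal to the (transposed) unique Nash equilibrium $x^*$ of the game. Then the iterates of the distributed gradient play $$\mathbf{x}^{t+1}=W\mathbf{x}^t-\alpha\tilde{\mathbf{F}}(\mathbf{x}^t),\qquad t=0,1,2,\ldots,$$ started from any $\mathbf{x}^0\in\mathbb{R}^{n\times n}$, converge to $\mathbf{x}^*$. Moreover, there is $q=q(\alpha)\in(0,1)$ such that $\|\mathbf{x}^t-\mathbf{x}^*\|_{\mathrm{Fro}}^2\le O(q^t)$, i.e. for every $\mathbf{x}^0$ there is a constant $C$ (independent of $t$) with $\|\mathbf{x}^t-\mathbf{x}^*\|_{\mathrm{Fro}}^2\le Cq^t$ for all $t\ge 0$.
   Context: $[n]=\{1,\ldots,n\}$. For $x\in\mathbb{R}^n$, $x_i\in\mathbb{R}$ is the action of player $i$ and $x_{-i}\in\mathbb{R}^{n-1}$ is the joint action of all other players; $J_i(x)=J_i(x_i,x_{-i})$. $\nabla_iJ_i(x)=\partial J_i(x)/\partial x_i$. $\|\cdot\|$ is the Euclidean norm on $\mathbb{R}^n$ and $\|\cdot\|_{\mathrm{Fro}}$ the Frobenius norm on $\mathbb{R}^{n\times n}$. Graph: $\mathcal{A}\subseteq[n]\times[n]$ is symmetric, i.e. $(i,j)\in\mathcal{A}$ iff $(j,i)\in\mathcal{A}$. Doubly stochastic means all row sums and column sums equal $1$; $W$ need not be symmetric. With $\bar x=\frac1n\mathbf{1}^Tx$, the second largest singular value $\sigma$ of $W$ satisfies $\|Wx-\mathbf{1}\bar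 x\|\le\sigma\|x-\mathbf{1}\bar x\|$ for all $x\in\mathbb{R}^n$. Nash equilibrium: a vector $x^*\in\mathbb{R}^n$ such that $J_i(x_i^*,x_{-i}^* )\le J_i(x_i,x_{-i}^* )$ for all $i\in[n]$ and all $x_i\in\mathbb{R}$. Under strong monotonicity of $\mathbf{F}$ the game has a unique Nash equilibrium, and it is characterized by $\mathbf{F}(x^* )=0$. Estimation matrix: for $\mathbf{x}\in\mathbb{R}^{n\times n}$, its $i$th row, viewed as a vector $x_{(i)}\in\mathbb{R}^n$, is player $i$'s estimate of the joint action (its $i$th entry being player $i$'s own action). $\tilde{\mathbf{F}}(\mathbf{x})\in\mathbb{R}^{n\times n}$ is the diagonal matrix $\mathrm{Diag}(\nabla_1J_1(x_{(1)}),\ldots,\nabla_nJ_n(x_{(n)}))$. *)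

(* Defs.v *)
From HB Require Import structures.
From mathcomp Require Import all_boot all_order all_algebra.
From mathcomp Require Import all_classical all_reals all_analysis.

Set Implicit Arguments.
Unset Strict Implicit.
Unset Printing Implicit Defensive.

Import Order.TTheory GRing.Theory Num.Theory numFieldNormedType.Exports.

Local Open Scope classical_set_scope.
Local Open Scope ring_scope.

Section Euclidean.
Context {R : realType}.

(* The library norm `|A| on matrices is the sup norm. On a row vector fronorm
   is the Euclidean norm, on a square matrix the Frobenius norm. *)
Definition fronorm m n (A : 'M[R]_(m, n)) : R :=
  Num.sqrt (\sum_i \sum_j A i j ^+ 2).

Definition inner n (x y : 'rV[R]_n) : R := \sum_i x 0 i * y 0 i.

(* s lists the singular values of A in nonincreasing order, with multiplicity:
   the square roots of the eigenvalues of A^T A. *)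
Definition singular_values n (A : 'M[R]_n) (s : seq R) : Prop :=
  [/\ sorted >=%R s, all (fun x => 0 <= x) s &
      char_poly (A^T *m A) = \prod_(x <- s) ('X - (x ^+ 2)%:P)].

Definition second_singular_value n (A : 'M[R]_n) (sigma : R) : Prop :=
  exists2 s, singular_values A s & sigma = s`_1.

Definition doubly_stochastic n (W : 'M[R]_n) : Prop :=
  [/\ forall i j, 0 <= W i j, forall i, \sum_j W i j = 1 &
      forall j, \sum_i W i j = 1].

End Euclidean.

Definition connected_graph n (A : rel 'I_n) : Prop :=
  forall i j, connect A i j.

Section Game.
Context {R : realType} {n : nat}.
Implicit Types (J : 'I_n -> 'rV[R]_n -> R) (x : 'rV[R]_n).

(* The joint action (t, x_{-i}). *)
Definition set_action x (i : 'I_n) (t : R) : 'rV[R]_n :=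
  \row_j (if j == i then t else x 0 j).

Definition partial J (i : 'I_n) x : R :=
  derive1 (fun t => J i (set_action x i t)) (x 0 i).

Definition C1_own_action J : Prop :=
  forall i x, (forall t, derivable (fun s => J i (set_action x i s)) t 1) /\
    continuous (fun t => partial J i (set_action x i t)).

Definition game_mapping J x : 'rV[R]_n := \row_i partial J i x.

Definition strongly_monotone (F : 'rV[R]_n -> 'rV[R]_n) (mu : R) : Prop :=
  forall x y, mu * fronorm (x - y) ^+ 2 <= inner (F x - F y) (x - y).

Definition nash_equilibrium J x : Prop :=
  forall i t, J i x <= J i (set_action x i t).

(* Row i of X is player i's estimate of the joint action. *)
Definition Ftilde J (X : 'M[R]_n) : 'M[R]_n :=
  diag_mx (\row_i partial J i (row i X)).

Definition gradient_play J (W : 'M[R]_n) (alpha : R) (X0 : 'M[R]_n) (t : nat) :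
    'M[R]_n :=
  iter t (fun X => W *m X - alpha *: Ftilde J X) X0.

Definition consensus x : 'M[R]_n := \matrix_(i, j) x 0 j.

End Game.

Definition step_bound {R : realType} (n : nat) (mu L sigma : R) : R :=
  let n' : R := n%:R in
  let r := Num.sqrt (1 + sigma ^+ 2) in
  Num.min 1
 (Num.min (mu / (2 * L ^+ 2))
 (Num.min (sigma / (2 * L) * (Num.sqrt n' / Num.sqrt (n' - 1)) *
             (Num.sqrt 2 / r - 1))
 (Num.min (n' / mu * (8 / (r - Num.sqrt 2) ^+ 2 - 1))
          ((Num.sqrt (n' ^+ 2 + 2 * mu ^+ 4 * (1 - sigma ^+ 2) /
                        ((n' - 1) * L ^+ 4 * (1 + sigma ^+ 2))) - n')
             / (2 * mu))))).

(* Main.v *)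
Require Import Defs.
From HB Require Import structures.
From mathcomp Require Import all_boot all_order all_algebra.
From mathcomp Require Import all_classical all_reals all_analysis.
From mathcomp Require Import ring lra.
From mathcomp Require complex.

(* Let y be the zero of F. Split an estimation matrix X into its row mean m and
   its deviation E from consensus, so that the squared distance of X to the
   consensus on y is D + S with D = n |m - y|^2 and S = |E|^2. Strong
   monotonicity (for D) and the spectral gap of W (for S) give, with
   k = alpha L sqrt((n-1)/n) and s = sigma + k < 1,
     D' <= (1 - alpha mu / (2n)) D + 5 alpha L^2 / (2 mu) S,
     S' <= k^2 / (1 - s) D + s S
   after one step. The step size bounds make the product of the off-diagonal
   coefficients smaller than alpha mu (1 - s) / (2n), so that D + theta S decays
   geometrically for some theta > 0. *)

Set Implicit Arguments.
Unset Strict Implicit.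
Unset Printing Implicit Defensive.

Import Order.TTheory GRing.Theory Num.Theory numFieldNormedType.Exports.

Local Open Scope classical_set_scope.
Local Open Scope ring_scope.

(** * Scalar inequalities *)

Section Scalars.
Variable R : realType.
Implicit Types sigma mu L alpha k : R.

(** Convexity of the square: the difference of the two sides is a positive combination of three
    squares, as in Lagrange's identity. *)
Lemma sqr_sum3_le (w1 w2 w3 x y z : R) : 0 < w1 -> 0 < w2 -> 0 < w3 ->
  w1 + w2 + w3 = 1 ->
  (x + y + z) ^+ 2 <= x ^+ 2 / w1 + y ^+ 2 / w2 + z ^+ 2 / w3.
Proof.
move=> w10 w20 w30 wE.
have -> : x ^+ 2 / w1 + y ^+ 2 / w2 + z ^+ 2 / w3 = (x + y + z) ^+ 2 +
   ((w1 * y - w2 * x) ^+ 2 / (w1 * w2) + (w1 * z - w3 * x) ^+ 2 / (w1 * w3)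
   + (w2 * z - w3 * y) ^+ 2 / (w2 * w3)).
  have -> : w3 = 1 - w1 - w2 by lra.
  have h : 1 - w1 - w2 != 0 by apply/lt0r_neq0; lra.
  by field; rewrite h !lt0r_neq0.
rewrite lerDl !addr_ge0 // divr_ge0 ?sqr_ge0 // mulr_ge0 ?ltW //.
Qed.

(** Brings the step size bounds into the form in which the one-step estimates and their coupling use
    them. *)
Lemma step_bound_consequences n mu L sigma alpha :
  (2 <= n)%N -> 0 < mu -> 0 < L -> 0 < sigma < 1 ->
  0 < alpha < step_bound n mu L sigma ->
  let N : R := n%:R in
  [/\ alpha < 1, alpha * L ^+ 2 <= mu / 2,
      alpha * L * (Num.sqrt (N - 1) / Num.sqrt N)
        <= sigma * (1 - sigma ^+ 2) / (4 * (1 + sigma ^+ 2)) &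
      alpha * N * (N - 1) * (2 * L ^+ 4 * (1 + sigma ^+ 2))
        <= mu ^+ 3 * (1 - sigma ^+ 2)].
Proof.
move=> n2 mu0 L0 /andP[s0 s1] + N.
rewrite /step_bound /= -/N !lt_min => /and5P[a0 a1 a2 a3 /andP[_ a5]].
have N2 : 2 <= N by rewrite (ler_nat _ 2).
have s2 : 0 < 1 - sigma ^+ 2 by rewrite subr_gt0 expr_lt1 // ltW.
have s2' : 0 < 1 + sigma ^+ 2 by rewrite ltr_pwDl // sqr_ge0.
split=> //.
- move: a2; rewrite ltr_pdivlMr ?mulr_gt0 ?exprn_gt0 //; nra.
- set p := Num.sqrt N in a3 *; set q := Num.sqrt (N - 1) in a3 *.
  have p0 : 0 < p by rewrite sqrtr_gt0; lra.
  have q0 : 0 < q by rewrite sqrtr_gt0; lra.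
  set rho := Num.sqrt 2 / Num.sqrt (1 + sigma ^+ 2) in a3.
  have rhoE : rho ^+ 2 = 2 / (1 + sigma ^+ 2).
    by rewrite expr_div_n !sqr_sqrtr // ltW.
  (* The tangent bound [rho - 1 <= (rho ^+ 2 - 1) / 2] removes the square root. *)
  have rhole : rho - 1 <= (1 - sigma ^+ 2) / (2 * (1 + sigma ^+ 2)).
    have -> : (1 - sigma ^+ 2) / (2 * (1 + sigma ^+ 2)) = (rho ^+ 2 - 1) / 2.
      by rewrite rhoE; field; lra.
    have := sqr_ge0 (rho - 1); rewrite sqrrB1; lra.
  have {a3} : alpha * (L * (q / p)) <= sigma / 2 * (rho - 1).
    have -> : sigma / 2 * (rho - 1) =
        sigma / (2 * L) * (p / q) * (rho - 1) * (L * (q / p)).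
      by field; rewrite !lt0r_neq0.
    by rewrite ler_wpM2r ?ltW // mulr_gt0 // divr_gt0.
  rewrite mulrA => /le_trans; apply.
  have -> : sigma * (1 - sigma ^+ 2) / (4 * (1 + sigma ^+ 2)) =
     sigma / 2 * ((1 - sigma ^+ 2) / (2 * (1 + sigma ^+ 2))) by field; lra.
  by rewrite ler_wpM2l // ltW // divr_gt0.
- set c := 2 * mu ^+ 4 * _ / _ in a5.
  have c0 : 0 < c.
    rewrite /c divr_gt0 // ?mulr_gt0 ?exprn_gt0 //; lra.
  move: a5; rewrite ltr_pdivlMr ?mulr_gt0 // ltrBrDr => a5.
  (* The last bound, squared. Dropping [(2 * alpha * mu) ^+ 2] from its expansion leaves a bound
     linear in [alpha]. *)
  have : (alpha * (2 * mu) + N) ^+ 2 <= N ^+ 2 + c.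
    rewrite -[leRHS]sqr_sqrtr; last by rewrite addr_ge0 ?sqr_ge0 // ltW.
    by rewrite ler_pXn2r ?nnegrE ?sqrtr_ge0 ?addr_ge0 ?mulr_ge0 // ?ltW //; lra.
  have h1 : 4 * alpha * mu * N <= (alpha * (2 * mu) + N) ^+ 2 - N ^+ 2.
    have -> : (alpha * (2 * mu) + N) ^+ 2 - N ^+ 2 =
        4 * alpha * mu * N + (2 * alpha * mu) ^+ 2 by ring.
    by rewrite lerDl sqr_ge0.
  move=> h2; have : 4 * alpha * mu * N <= c by lra.
  rewrite /c ler_pdivlMr; last by rewrite !mulr_gt0 ?exprn_gt0 //; lra.
  move=> h3.
  have mu2 : 0 < 2 * mu by lra.
  rewrite -(ler_pM2l mu2); move: h3; congr (_ <= _); ring.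
Qed.

(* The two bounds on [alpha] yield [1 - (sigma + k) >= (11/16) (1 - sigma)] and
   [5 n k^2 L^2 / mu^2 <= (25/56) (1 - sigma)^2], while [25/56 < (11/16)^2]. *)
Lemma coupling_lt n mu L sigma alpha (k := alpha * L *
    (Num.sqrt (n%:R - 1) / Num.sqrt n%:R)) :
  (2 <= n)%N -> 0 < mu <= L -> 0 < sigma < 1 -> 0 < alpha ->
  k <= sigma * (1 - sigma ^+ 2) / (4 * (1 + sigma ^+ 2)) ->
  alpha * n%:R * (n%:R - 1) * (2 * L ^+ 4 * (1 + sigma ^+ 2))
    <= mu ^+ 3 * (1 - sigma ^+ 2) ->
  [/\ 0 < k, sigma + k < 1 &
   5 * n%:R * k ^+ 2 * L ^+ 2 < mu ^+ 2 * (1 - (sigma + k)) ^+ 2].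
Proof.
move=> n2 /andP[mu0 muL] /andP[s0 s1] a0.
rewrite {}/k; set N : R := n%:R; set p := Num.sqrt (N - 1) / Num.sqrt N => k1 k2.
have N2 : 2 <= N by rewrite (ler_nat _ 2).
have L0 : 0 < L by lra.
have N0 : 0 < N by lra.
have N1 : 0 < N - 1 by lra.
have s2 : 0 < 1 - sigma ^+ 2 by rewrite subr_gt0 expr_lt1 // ltW.
have s2' : 0 < 1 + sigma ^+ 2 by rewrite ltr_pwDl // sqr_ge0.
have p0 : 0 < p by rewrite divr_gt0 // sqrtr_gt0; lra.
have pE : p ^+ 2 * N = N - 1.
  rewrite expr_div_n !sqr_sqrtr; [field| |]; lra.
(* [p / (N - 1)] is the inverse square root of [N * (N - 1) >= 2], and 5/7 is a rational just above
   the inverse square root of 2. *)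
have ple : p <= 5 / 7 * (N - 1).
  have h1 : 0 <= 5 / 7 * (N - 1) by nra.
  rewrite -(@ler_pXn2r _ 2 isT) ?nnegrE ?(ltW p0) //.
  have h2 : 2 <= (N - 1) * N by nra.
  have h3 : 0 <= (N - 1) * (25 / 49 * ((N - 1) * N) - 1).
    by rewrite mulr_ge0 //; lra.
  rewrite -(ler_pM2r N0) pE; lra.
set k := alpha * L * p.
have k0 : 0 < k by rewrite /k mulr_gt0 // mulr_gt0.
move: k1; rewrite -/k => k1.
(* Given the first bound on [k], this reduces to [4 * sigma * (1 + sigma) <= 5 * (1 + sigma ^+
   2)]. *)
have k1' : k <= 5 / 16 * (1 - sigma).
  apply: (le_trans k1); rewrite ler_pdivrMr ?mulr_gt0 //.
  have -> : 5 / 16 * (1 - sigma) * (4 * (1 + sigma ^+ 2)) =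
    sigma * (1 - sigma ^+ 2) + (1 - sigma) * ((sigma / 2 - 1) ^+ 2 + 1/4) by field.
  rewrite lerDl mulr_ge0 //; first lra.
  by have := sqr_ge0 (sigma / 2 - 1); lra.
have sk : 11 / 16 * (1 - sigma) <= 1 - (sigma + k) by lra.
split=> //; first lra.
(* [n k] is controlled by the second bound, the other factor [k] by the first. *)
have nk : N * k * (2 * L ^+ 3 * (1 + sigma ^+ 2)) <=
    5 / 7 * (mu ^+ 3 * (1 - sigma ^+ 2)).
  rewrite -(ler_pM2r N1).
  have -> : N * k * (2 * L ^+ 3 * (1 + sigma ^+ 2)) * (N - 1) =
    p * (alpha * N * (N - 1) * (2 * L ^+ 4 * (1 + sigma ^+ 2))).
    by rewrite /k; ring.
  have -> : 5 / 7 * (mu ^+ 3 * (1 - sigma ^+ 2)) * (N - 1) =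
    (5 / 7 * (N - 1)) * (mu ^+ 3 * (1 - sigma ^+ 2)) by ring.
  apply: ler_pM => //; first exact: ltW.
  by rewrite ltW // !mulr_gt0 // exprn_gt0.
clearbody k.
have nk' : N * k * L ^+ 2 * (2 * (1 + sigma ^+ 2)) <=
    5 / 7 * (mu ^+ 2 * (1 - sigma ^+ 2)).
  rewrite -(ler_pM2r L0).
  have -> : N * k * L ^+ 2 * (2 * (1 + sigma ^+ 2)) * L =
     N * k * (2 * L ^+ 3 * (1 + sigma ^+ 2)) by ring.
  apply: (le_trans nk).
  have -> : 5 / 7 * (mu ^+ 3 * (1 - sigma ^+ 2)) =
    5 / 7 * (mu ^+ 2 * (1 - sigma ^+ 2)) * mu by ring.
  have c57 : 0 <= 5 / 7 :> R by lra.
  apply: ler_wpM2l => //; apply: mulr_ge0 => //.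
  by apply: mulr_ge0; [exact: sqr_ge0 | exact: ltW].
have k1'' : k * (4 * (1 + sigma ^+ 2)) <= sigma * (1 - sigma ^+ 2).
  by move: k1; rewrite ler_pdivlMr ?mulr_gt0.
have sE : 0 < (1 + sigma ^+ 2) ^+ 2 by rewrite exprn_gt0.
apply: (@lt_le_trans _ _ (mu ^+ 2 * (11 / 16 * (1 - sigma)) ^+ 2)); last first.
  by rewrite ler_wpM2l ?sqr_ge0 // ler_pXn2r ?nnegrE //; lra.
rewrite -(ltr_pM2r sE).
have prod : N * k * L ^+ 2 * (2 * (1 + sigma ^+ 2)) * (k * (4 * (1 + sigma ^+ 2)))
    <= 5 / 7 * (mu ^+ 2 * (1 - sigma ^+ 2)) * (sigma * (1 - sigma ^+ 2)).
  apply: ler_pM => //; rewrite ltW //; first by rewrite !mulr_gt0 // exprn_gt0.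
  by rewrite mulr_gt0 // mulr_gt0.
(* Absorbs the factors [sigma] and [(1 + sigma) ^+ 2] that are left once [1 - sigma ^+ 2] is
   factored. *)
have sig : sigma * (1 + sigma) ^+ 2 <= (1 + sigma ^+ 2) ^+ 2.
  have -> : (1 + sigma ^+ 2) ^+ 2 = sigma * (1 + sigma) ^+ 2 +
     ((1 - sigma) ^+ 2 * (1 + sigma + sigma ^+ 2)) by ring.
  by rewrite lerDl mulr_ge0 ?sqr_ge0 //; nra.
have Q0 : 0 < mu ^+ 2 * (1 - sigma) ^+ 2 by rewrite mulr_gt0 ?exprn_gt0 //; lra.
have : mu ^+ 2 * (1 - sigma) ^+ 2 * (sigma * (1 + sigma) ^+ 2) <=
       mu ^+ 2 * (1 - sigma) ^+ 2 * (1 + sigma ^+ 2) ^+ 2 by rewrite ler_pM2l.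
have Q1 := mulr_gt0 Q0 sE.
have -> : 5 * N * k ^+ 2 * L ^+ 2 * (1 + sigma ^+ 2) ^+ 2 =
  5 / 8 * (N * k * L ^+ 2 * (2 * (1 + sigma ^+ 2)) *
    (k * (4 * (1 + sigma ^+ 2)))) by field.
move: prod.
have -> : 5 / 7 * (mu ^+ 2 * (1 - sigma ^+ 2)) * (sigma * (1 - sigma ^+ 2)) =
  5 / 7 * (mu ^+ 2 * (1 - sigma) ^+ 2 * (sigma * (1 + sigma) ^+ 2)) by field.
have -> : mu ^+ 2 * (11 / 16 * (1 - sigma)) ^+ 2 * (1 + sigma ^+ 2) ^+ 2 =
  121 / 256 * (mu ^+ 2 * (1 - sigma) ^+ 2 * (1 + sigma ^+ 2) ^+ 2) by field.
lra.
Qed.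

(** If [D' <= (1 - a) D + b S] and [S' <= c D + s S], then [D + theta S] contracts for [theta]
    strictly between [b / (1 - s)] and [a / c]. The last hypothesis makes this interval nonempty,
    and its midpoint is taken. *)
Lemma lyapunov_weight (a b c s : R) :
  0 < a < 1 -> 0 < b -> 0 < c -> 0 < s < 1 -> b * c < a * (1 - s) ->
  exists theta q, [/\ 0 < theta, 0 < q < 1,
    1 - a + theta * c <= q & b + theta * s <= q * theta].
Proof.
move=> /andP[a0 a1] b0 c0 /andP[s0 s1] h.
have s1' : 0 < 1 - s by lra.
pose l := b / (1 - s); pose u := a / c.
have lu : l < u by rewrite ltr_pdivrMr // mulrAC ltr_pdivlMr.
have l0 : 0 < l by rewrite divr_gt0.
pose t := (l + u) / 2.
have lt : l < t by rewrite /t; lra.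
have tu : t < u by rewrite /t; lra.
have t0 : 0 < t by lra.
have tc : t * c < a by rewrite -ltr_pdivlMr.
have tb : b < t * (1 - s) by rewrite -ltr_pdivrMr.
exists t, (Num.max (1 - a + t * c) (b / t + s)); split=> //.
- rewrite lt_max gt_max; apply/andP; split.
    by apply/orP; left; have := mulr_gt0 t0 c0; lra.
  apply/andP; split; first lra.
  by rewrite -ltrBrDr ltr_pdivrMr // mulrC.
- by rewrite le_max lexx.
- have -> : b + t * s = (b / t + s) * t by field; rewrite lt0r_neq0.
  by rewrite ler_pM2r // le_max lexx orbT.
Qed.

End Scalars.

(** * The second singular value of a doubly stochastic matrix *)

Lemma char_poly_conj (F : fieldType) n (P A B : 'M[F]_n) :
  P \in unitmx -> P *m A = B *m P -> char_poly A = char_poly B.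
Proof.
rewrite unitmxE unitfE => detP0 PAB.
have detP0' : \det (map_mx polyC P) != 0 by rewrite det_map_mx polyC_eq0.
apply: (mulfI detP0'); rewrite [RHS]mulrC -!det_mulmx; congr (\det _).
rewrite /char_poly_mx mulmxBr mulmxBl -!map_mxM PAB; congr (_ - _).
by rewrite scalar_mxC.
Qed.

(** Monotonicity leaves only the head free to exceed the entry at index 1. On shorter lists that
    entry is the default 0, and the count is at most 1 anyway. *)
Lemma count_gt_second (R : realDomainType) (s : seq R) (c : R) :
  sorted >=%R s -> s`_1 <= c -> (count (fun x => (c < x)%R) s <= 1)%N.
Proof.
case: s => [|x [|y s]] //=; first by case: (_ < _).
move=> /andP[_ ys] yc.
rewrite [c < y]ltNge yc /= add0n.
have -> : count (fun z => (c < z)%R) s = 0%N; last by case: (_ < _).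
apply/eqP; rewrite -leqn0 leqNgt -has_count; apply/hasPn => z zs.
have := order_path_min (@ge_trans _ R) ys => /allP/(_ z zs) /= zy.
by rewrite -leNgt (le_trans zy).
Qed.

Section SecondSingularValue.
Import complex.
Variables (R : realType) (n : nat) (W : 'M[R]_n) (sigma : R).
Hypotheses (dsW : doubly_stochastic W) (svW : second_singular_value W sigma).
Hypothesis (sigma01 : 0 <= sigma < 1).

Local Notation toC := (real_complex R : {rmorphism R -> R[i]}).
Local Notation cmx := (map_mx toC).
Local Notation "A ^t*" := (map_mx Num.conj A^T).
(** The Gram matrix is real symmetric, hence normal over the complex numbers, where the unitary [P]
    diagonalises it. The eigenvalues [D] are the squared singular values of [W]. *)
Let S := W^T *m W.
Let P := spectralmx (cmx S).
Let D := spectral_diag (cmx S).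

Let conj_toC m p (A : 'M[R]_(m, p)) : (cmx A)^t* = cmx A^T.
Proof. by apply/matrixP => i j; rewrite !mxE conj_Creal // complex_real. Qed.

Let SE : cmx S = P^t* *m diag_mx D *m P.
Proof.
rewrite -invmx_unitary ?spectral_unitarymx //; apply/orthomx_spectralP.
apply/normalmxP; rewrite conj_toC.
by rewrite /S trmx_mul trmxK.
Qed.

Let PPt : P *m P^t* = 1%:M.
Proof. by apply/unitarymxP/spectral_unitarymx. Qed.

Let PtP : P^t* *m P = 1%:M.
Proof. exact: mulmx1C PPt. Qed.

(** Coordinates of the rows of [u] in the orthonormal eigenbasis formed by the rows of [P]. *)
Let y m (u : 'M[R]_(m, n)) := cmx u *m P^t*.

(** Parseval's identity, as the change of basis is unitary. *)
Let yE m p (u : 'M[R]_(m, n)) (v : 'M[R]_(p, n)) :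
  cmx (u *m v^T) = y u *m (y v)^t*.
Proof.
rewrite /y trmx_mul !map_mxM /= -!mulmxA (mulmxA (P^t*)).
have -> : map_mx Num.conj (P^t*)^T = P.
  by apply/matrixP => i j; rewrite !mxE conjCK.
by rewrite PtP mul1mx conj_toC.
Qed.

Let yS m p (u : 'M[R]_(m, n)) (v : 'M[R]_(p, n)) :
  cmx (u *m S *m v^T) = y u *m diag_mx D *m (y v)^t*.
Proof.
rewrite map_mxM map_mxM SE /y trmx_mul map_mxM /= -!mulmxA.
have -> : map_mx Num.conj (P^t*)^T = P.
  by apply/matrixP => i j; rewrite !mxE conjCK.
by rewrite conj_toC.
Qed.

(** Both lists are the roots, with multiplicity, of the characteristic polynomial of [S]. *)
Let permD (s : seq R) : singular_values W s ->
  perm_eq [seq D 0 i | i : 'I_n] [seq toC (x ^+ 2) | x <- s].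
Proof.
move=> [_ _ cS]; apply: prod_XsubC_eq.
have /(congr1 (map_poly toC)) := cS; rewrite map_char_poly.
rewrite (char_poly_conj (P := P) (B := diag_mx D)); last 2 first.
- exact: spectral_unit.
- by rewrite SE !mulmxA PPt mul1mx.
rewrite char_poly_trig ?diag_mx_is_trig //.
rewrite rmorph_prod !big_map /= => eqD.
transitivity (\prod_(i < n) ('X - (diag_mx D i i)%:P)).
  by apply: eq_bigr => i _; rewrite !mxE eqxx mulr1n.
rewrite eqD; apply: eq_bigr => x _.
by rewrite rmorphB /= map_polyX map_polyC.
Qed.

(** At most one singular value exceeds [sigma], and since [sigma < 1] the eigenvalue 1 at [i0]
    already accounts for it. *)
Let D_le i0 j : D 0 i0 = 1 -> j != i0 -> D 0 j <= toC (sigma ^+ 2).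
Proof.
move=> Di0 ji0; case: svW => s ss sE; have := permD ss => pD.
case: ss => sorteds ges _.
have /mapP[x xs Dx] : D 0 j \in [seq toC (z ^+ 2) | z <- s].
  by rewrite -(perm_mem pD); apply/mapP; exists j; rewrite ?mem_enum.
rewrite Dx lecR leNgt; apply/negP => lt_x.
have := count_gt_second sorteds; rewrite -sE => /(_ _ (lexx _)).
have -> : count (fun z => (sigma < z)%R) s =
    count (fun w : R[i] => toC (sigma ^+ 2) < w) [seq toC (z ^+ 2) | z <- s].
  rewrite count_map; apply: eq_in_count => z zs /=.
  rewrite ltcR ltr_pXn2r ?nnegrE //; last by move/allP: ges => /(_ z zs).
  by case/andP: sigma01.
rewrite -(permP pD) count_map -size_filter; apply/negP; rewrite -ltnNge.
have sub : [:: i0; j] \subset [pred i | toC (sigma ^+ 2) < D 0 i].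
  apply/fintype.subsetP => i; rewrite !inE => /orP[] /eqP ->; last by rewrite Dx ltcR.
  rewrite Di0 (ltcR _ 1); case/andP: sigma01 => s0 s1.
  by rewrite expr_lt1.
have := subset_leq_card sub; rewrite (card_uniqP _) /=; last first.
  by rewrite inE eq_sym ji0.
by rewrite cardE [enum 'I_n]enumT.
Qed.

(** The all-ones vector [e] is fixed by [S], as rows and columns of [W] sum to 1. The eigenvalue 1
    is simple, so [e] spans its eigenspace, and [v], being orthogonal to [e], only has components
    with eigenvalue at most [sigma ^+ 2]. *)
Lemma second_singular_value_contraction (v : 'cV[R]_n) :
  \sum_i v i 0 = 0 ->
  \sum_i (W *m v) i 0 ^+ 2 <= sigma ^+ 2 * \sum_i v i 0 ^+ 2.
Proof.
move=> sumv; have [W0 W1r W1c] := dsW.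
pose e : 'rV[R]_n := const_mx 1; pose u := v^T.
have eS : e *m S = e.
  apply/rowP => j; rewrite /S mulmxA !mxE -[RHS](W1c j); apply: eq_bigr => i _.
  rewrite !mxE -[RHS]mul1r -(W1r i); congr (_ * _); apply: eq_bigr => k _.
  by rewrite !mxE mul1r.
have ye : y e *m diag_mx D = y e.
  rewrite -[RHS]/(cmx e *m P^t*) -[in RHS]eS map_mxM SE -!mulmxA PPt mulmx1.
  by rewrite /y mulmxA.
have yei i : y e 0 i * (D 0 i - 1) = 0.
  have /rowP/(_ i) := ye; rewrite mul_mx_diag mxE => h.
  by rewrite mulrBr mulr1 h subrr.
have normE : toC (\sum_i v i 0 ^+ 2) = \sum_i y u 0 i * (y u 0 i)^*.
  have := yE u u => /matrixP/(_ 0 0); rewrite mxE [in RHS]mxE => h.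
  transitivity (toC ((u *m u^T) 0 0)).
    by apply: (congr1 toC); rewrite mxE; apply: eq_bigr => i _; rewrite !mxE.
  by rewrite [LHS]h; apply: eq_bigr => i _; rewrite !mxE.
have quadE : toC (\sum_i (W *m v) i 0 ^+ 2) = \sum_i D 0 i * (y u 0 i * (y u 0 i)^*).
  have := yS u u => /matrixP/(_ 0 0); rewrite mxE [in RHS]mxE => h.
  transitivity (toC ((u *m S *m u^T) 0 0)).
    apply: (congr1 toC); rewrite /S mulmxA -trmx_mul -mulmxA trmxK mxE.
    by apply: eq_bigr => i _; rewrite !mxE.
  rewrite [LHS]h; apply: eq_bigr => i _; rewrite mul_mx_diag !mxE.
  by rewrite mulrA (mulrC (D 0 i)).
have orthE : \sum_i y u 0 i * (y e 0 i)^* = 0.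
  have := yE u e => /matrixP/(_ 0 0); rewrite mxE [in RHS]mxE => h.
  transitivity (toC ((u *m e^T) 0 0)).
    by rewrite [RHS]h; apply: eq_bigr => i _; rewrite !mxE.
  rewrite mxE (eq_bigr (fun i => v i 0)) ?sumv ?rmorph0 // => i _.
  by rewrite !mxE mulr1.
rewrite -lecR quadE rmorphM normE mulr_sumr.
apply: ler_sum => i _.
(* The index [i] at hand shows that [e] is nonzero, so some coordinate of it is nonzero. *)
have [n0|[i0 yi0]] : (forall i, y e 0 i = 0) \/ exists i0, y e 0 i0 != 0.
  have [|] := pselect (exists i0, y e 0 i0 != 0); [by right|left => k].
  by apply/eqP/negPn/negP => h; apply: b; exists k.
  have : cmx e = 0.
    rewrite -[cmx e]mulmx1 -PtP mulmxA -/(y e).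
    have -> : y e = 0 by apply/rowP => k; rewrite n0 mxE.
    by rewrite mul0mx.
  by move/rowP/(_ i); rewrite !mxE rmorph1 => /eqP; rewrite oner_eq0.
have Di0 : D 0 i0 = 1.
  have /eqP := yei i0; rewrite mulf_eq0 (negbTE yi0) /= subr_eq0.
  by move/eqP.
have [->|ii0] := eqVneq i i0; last first.
  by rewrite ler_wpM2r ?mul_conjC_ge0 // (D_le Di0).
(* By simplicity of the eigenvalue 1, [y e] vanishes off [i0], so orthogonality to [e] concerns this
   coordinate alone. *)
have -> : y u 0 i0 = 0.
  move: orthE; rewrite (bigD1 i0) //= big1 ?addr0 => [/eqP|j ji0].
    by rewrite mulf_eq0 conjC_eq0 (negbTE yi0) orbF => /eqP.
  have /eqP := yei j; rewrite mulf_eq0 => /orP[/eqP ->|].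
    by rewrite rmorph0 mulr0.
  rewrite subr_eq0 => /eqP Dj; have := D_le Di0 ji0; rewrite Dj.
  case/andP: sigma01 => s0 s1.
  by rewrite (lecR 1) leNgt expr_lt1 // s1.
by rewrite mul0r !mulr0.
Qed.

End SecondSingularValue.

(** * Nash equilibria of strongly monotone games *)

(** Joins completeness to the normed structure, as Banach's fixed point theorem requires. *)
HB.instance Definition _ (R : realType) m n := Complete.on 'M[R]_(m, n).

(** * Comparison of the Euclidean and sup norms *)

Section Fronorm.
Variable R : realType.

Lemma fronorm_sqr m n (A : 'M[R]_(m, n)) :
  fronorm A ^+ 2 = \sum_i \sum_j A i j ^+ 2.
Proof.
rewrite sqr_sqrtr // !sumr_ge0 // => i _.
by rewrite sumr_ge0 // => j _; rewrite sqr_ge0.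
Qed.

Lemma fronorm_row n (x : 'rV[R]_n) : fronorm x ^+ 2 = \sum_j x 0 j ^+ 2.
Proof. by rewrite fronorm_sqr big_ord1. Qed.

Lemma fronorm_ge0 m n (A : 'M[R]_(m, n)) : 0 <= fronorm A.
Proof. exact: sqrtr_ge0. Qed.

Lemma fronorm_eq0 n (x : 'rV[R]_n) : fronorm x ^+ 2 <= 0 -> x = 0.
Proof.
rewrite fronorm_row => x0; apply/rowP => j; rewrite mxE.
have : x 0 j ^+ 2 <= 0.
  apply: le_trans x0; rewrite (bigD1 j) //= lerDl sumr_ge0 // => k _.
  exact: sqr_ge0.
by move=> h; apply/eqP; rewrite -sqrf_eq0 eq_le h sqr_ge0.
Qed.

Lemma norm_le_fronorm m n (A : 'M[R]_(m, n)) : `|A| <= fronorm A.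
Proof.
rewrite [`|A|]/Num.norm /= mx_normrE; apply/bigmax_leP; split; first exact: fronorm_ge0.
move=> [i j] _ /=; rewrite -sqrtr_sqr ler_wsqrtr //.
rewrite (bigD1 i) //= (bigD1 j) //= -addrA lerDl addr_ge0 //.
  by rewrite sumr_ge0 // => k _; rewrite sqr_ge0.
by rewrite sumr_ge0 // => k _; rewrite sumr_ge0 // => l _; rewrite sqr_ge0.
Qed.

Lemma fronorm_le_norm n (x : 'rV[R]_n) : fronorm x ^+ 2 <= n%:R * `|x| ^+ 2.
Proof.
have -> : n%:R * `|x| ^+ 2 = \sum_(j < n) `|x| ^+ 2.
  by rewrite sumr_const card_ord mulr_natl.
rewrite fronorm_row.
apply: ler_sum => j _.
rewrite -real_normK ?num_real // ler_pXn2r ?nnegrE //.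
rewrite [`|x|]/Num.norm /= mx_normrE.
by apply/bigmax_geP; right; exists (0, j).
Qed.

End Fronorm.

(* A Euclidean contraction need not contract the sup norm which underlies the
   library's topology, but some iterate of it does. *)
Lemma euclidean_fixed_point (R : realType) n (T : 'rV[R]_n -> 'rV[R]_n) (q : R) :
  0 <= q < 1 ->
  (forall x y, fronorm (T x - T y) ^+ 2 <= q * fronorm (x - y) ^+ 2) ->
  exists x, T x = x.
Proof.
move=> /andP[q0 q1] Tq.
have Tk k x y : fronorm (iter k T x - iter k T y) ^+ 2 <= q ^+ k * fronorm (x - y) ^+ 2.
  elim: k => [|k IH] /=; first by rewrite expr0 mul1r.
  by rewrite [q ^+ _]exprS -mulrA (le_trans (Tq _ _)) // ler_wpM2l.
(* Comparing the norms costs a factor [n] on squares, so 1/4 gives the ratio 1/2 in the sup norm.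
   The exponent is positive to ensure [q ^+ k.+1 < 1] below. *)
have [k kn] : exists k, q ^+ k.+1 * n%:R <= (1 / 4 : R).
  have /cvgrPdist_le : (fun k => q ^+ k * n%:R) @ \oo --> (0 * n%:R : R).
    by apply: cvgMl; apply: cvg_expr; rewrite ger0_norm.
  move=> /(_ (1/4)) []; first by lra.
  move=> k _ /(_ k.+1 (leqnSn k)) /=; rewrite mul0r sub0r normrN => h.
  by exists k; rewrite (le_trans (ler_norm _)).
have [h0 h1] : (0 <= 1 / 2 :> R) /\ (1 / 2 < 1 :> R) by split; lra.
pose f := iter k.+1 T.
have fS : set_fun setT setT f by [].
pose F := mkfun_fun fS.
have ctr : is_contraction F.
  exists (NngNum h0); split => //= -[x y] _ /=.
  have := Tk k.+1 x y; rewrite -/f => h.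
  rewrite -(@ler_pXn2r _ 2) ?nnegrE ?mulr_ge0 //.
  apply: le_trans (_ : fronorm (f x - f y) ^+ 2 <= _).
    by rewrite ler_pXn2r ?nnegrE ?fronorm_ge0 // norm_le_fronorm.
  apply: (le_trans h).
  apply: le_trans (_ : q ^+ k.+1 * (n%:R * `|x - y| ^+ 2) <= _).
    by rewrite ler_wpM2l ?exprn_ge0 // fronorm_le_norm.
  rewrite mulrA exprMn; apply: ler_wpM2r; first exact: sqr_ge0.
  by apply: (le_trans kn); lra.
have [x _ xF] := banach_fixed_point ctr closedT (ex_intro _ 0 I).
have fx : f x = x by [].
(* [T] commutes with its iterate [f], so [T x] is a fixed point of [f] too and must equal [x]. *)
exists x; apply/subr0_eq/fronorm_eq0.
have := Tk k.+1 (T x) x; rewrite -iterSr iterS -/f fx.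
have := fronorm_ge0 (T x - x); set u := fronorm _.
move=> u0 h.
have qk : q ^+ k.+1 < 1 by rewrite exprn_ilt1.
have u2 : 0 <= u ^+ 2 by rewrite sqr_ge0.
rewrite leNgt; apply/negP => u2'; move: h; apply/negP; rewrite -ltNge.
by rewrite -[ltRHS]mul1r ltr_pM2r.
Qed.

(** Zeros of [F] are the fixed points of [x - g F x], a Euclidean contraction for a small step
    [g]. *)
Lemma strongly_monotone_zero (R : realType) n (F : 'rV[R]_n -> 'rV[R]_n)
    (mu K : R) : 0 < mu -> 0 <= K -> strongly_monotone F mu ->
  (forall x y, fronorm (F x - F y) ^+ 2 <= K * fronorm (x - y) ^+ 2) ->
  exists x, F x = 0.
Proof.
move=> mu0 K0 monF lipF.
pose M := K + mu ^+ 2; have mu2 : 0 < mu ^+ 2 by rewrite exprn_gt0.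
have M0 : 0 < M by rewrite /M; lra.
(* Squared distances shrink by [1 - 2 g mu + g ^+ 2 K], at most [1 - g mu] because
   [g ^+ 2 M = g mu]. The summand [mu ^+ 2] of [M] ensures [g mu <= 1]. *)
pose g := mu / M.
have g0 : 0 < g by rewrite divr_gt0.
pose q := 1 - g * mu.
have q01 : 0 <= q < 1.
  apply/andP; split; last by rewrite /q; have := mulr_gt0 g0 mu0; lra.
  by rewrite subr_ge0 /g mulrAC ler_pdivrMr // mul1r -expr2 /M lerDr.
have Tq x y : fronorm (x - g *: F x - (y - g *: F y)) ^+ 2 <=
    q * fronorm (x - y) ^+ 2.
  have -> : fronorm (x - g *: F x - (y - g *: F y)) ^+ 2 =
     fronorm (x - y) ^+ 2 - 2 * g * inner (F x - F y) (x - y)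
     + g ^+ 2 * fronorm (F x - F y) ^+ 2.
    rewrite !fronorm_row /inner !mulr_sumr -sumrB -big_split /=.
    by apply: eq_bigr => j _; rewrite !mxE; ring.
  have := monF x y; have := lipF x y.
  set a := inner _ _; set b := fronorm (x - y) ^+ 2; set c := fronorm _ ^+ 2.
  move=> cK ba; have b0 : 0 <= b by rewrite sqr_ge0.
  have : g ^+ 2 * c <= g * mu * b.
    apply: le_trans (_ : g ^+ 2 * (M * b) <= _).
      rewrite ler_wpM2l ?sqr_ge0 // (le_trans cK) // ler_wpM2r // /M; lra.
    rewrite /g le_eqVlt; apply/orP; left; apply/eqP; field; lra.
  have : g * (mu * b) <= g * a by rewrite ler_wpM2l // ltW.
  rewrite /q; lra.
have [x Tx] := euclidean_fixed_point (T := fun x => x - g *: F x) q01 Tq.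
exists x; move: Tx => /(congr1 (fun u => x - u)).
by rewrite subrr opprB addrC subrK => /eqP; rewrite scaler_eq0 gt_eqF //= => /eqP.
Qed.

(** * Nash equilibria as zeros of the game mapping *)

Section Nash.
Variables (R : realType) (n : nat) (J : 'I_n -> 'rV[R]_n -> R).
Implicit Types (x : 'rV[R]_n) (i : 'I_n).

Lemma set_action_set x i t s : set_action (set_action x i t) i s = set_action x i s.
Proof. by apply/rowP => j; rewrite !mxE; case: eqP. Qed.

Lemma set_action_id x i : set_action x i (x 0 i) = x.
Proof. by apply/rowP => j; rewrite !mxE; case: eqP => // ->. Qed.

Lemma partial_set_action x i t :
  partial J i (set_action x i t) = (fun s => J i (set_action x i s))^`()%classic t.
Proof.
rewrite /partial mxE eqxx.
by have -> : (fun s => J i (set_action (set_action x i t) i s)) =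
   (fun s => J i (set_action x i s))
  by apply/funext => s; rewrite set_action_set.
Qed.

(** Fermat's rule, on the interval of radius 1 about [x 0 i]; any radius would do. *)
Lemma nash_game_mapping0 x : C1_own_action J ->
  nash_equilibrium J x -> game_mapping J x = 0.
Proof.
move=> C1 nash; apply/rowP => i; rewrite !mxE /partial derive1E.
have [dJ _] := C1 i x.
apply: derive_val.
apply: (@derive1_at_min _ _ (x 0 i - 1) (x 0 i + 1)).
- lra.
- by move=> t _; exact: dJ.
- by rewrite in_itv /=; apply/andP; split; lra.
- by move=> t _; rewrite set_action_id; exact: nash.
Qed.

(** Monotonicity between [x] and a point that differs only in coordinate [i] shows that the own cost
    decreases before [x 0 i] and increases after it. *)
Lemma game_mapping0_nash mu x : C1_own_action J -> 0 <= mu ->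
  strongly_monotone (game_mapping J) mu -> game_mapping J x = 0 ->
  nash_equilibrium J x.
Proof.
move=> C1 mu0 monF Fx i t; have [dJ _] := C1 i x.
pose phi s := J i (set_action x i s); pose dphi s := partial J i (set_action x i s).
have sgn s : 0 <= dphi s * (s - x 0 i).
  have := monF (set_action x i s) x; rewrite Fx subr0.
  move/(le_trans (mulr_ge0 mu0 (sqr_ge0 _))); rewrite /inner (bigD1 i) //= big1.
    by rewrite addr0 !mxE eqxx.
  by move=> j ji; rewrite !mxE (negbTE ji) subrr mulr0.
have isd (s : R) : is_derive s 1 phi (dphi s).
  by rewrite /dphi partial_set_action derive1E; apply: derivableP; exact: dJ.
have cphi a b : {within `[a, b], continuous phi}.
  by apply: derivable_within_continuous => s _; exact: dJ.
(* The mean value point may be an endpoint; when it is [x 0 i], [dphi0] applies. *)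
have mvt a b : a <= b -> exists2 c, a <= c <= b & phi b - phi a = dphi c * (b - a).
  move=> ab; have [c] := @MVT_segment _ phi dphi a b ab (fun s _ => isd s) (cphi a b).
  by rewrite in_itv /=; exists c.
have dphi0 : dphi (x 0 i) = 0.
  by rewrite /dphi set_action_id; move/rowP/(_ i): Fx; rewrite !mxE.
rewrite -{1}(set_action_id x i) -/(phi (x 0 i)) -/(phi t).
have [xt|tx] := leP (x 0 i) t.
  have [c /andP[xc ct] E] := mvt _ _ xt.
  rewrite -subr_ge0 E; have := sgn c.
  move: xc; rewrite le_eqVlt => /orP[/eqP <-|xc]; first by rewrite dphi0 !mul0r.
  by rewrite pmulr_lge0 ?subr_gt0 // => c0; rewrite mulr_ge0 // subr_ge0.
have [c /andP[tc cx] E] := mvt _ _ (ltW tx).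
rewrite -subr_le0 E; have := sgn c.
move: cx; rewrite le_eqVlt => /orP[/eqP ->|cx]; first by rewrite dphi0 !mul0r.
by rewrite nmulr_lge0 ?subr_lt0 // => c0; rewrite mulr_le0_ge0 // subr_ge0 ltW.
Qed.

Lemma strongly_monotone_zero_inj (F : 'rV[R]_n -> 'rV[R]_n) mu x y :
  0 < mu -> strongly_monotone F mu -> F x = 0 -> F y = 0 -> x = y.
Proof.
move=> mu0 monF Fx Fy; apply/subr0_eq/fronorm_eq0.
rewrite -(pmulr_rle0 _ mu0); apply: le_trans (monF x y) _.
by rewrite Fx Fy subrr /inner big1 // => j _; rewrite mxE mul0r.
Qed.

(** Compares both conditions on the pair formed by the [i]th unit vector and 0. *)
Lemma strongly_monotone_le_lipschitz mu (Li : 'I_n -> R) i :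
  strongly_monotone (game_mapping J) mu ->
  (forall i x y, `|partial J i x - partial J i y| <= Li i * fronorm (x - y)) ->
  mu <= Li i.
Proof.
move=> monF lip; pose e := set_action (0 : 'rV[R]_n) i 1.
have e1 : fronorm (e - 0) ^+ 2 = 1.
  rewrite fronorm_row (bigD1 i) //= big1 ?addr0.
    by rewrite !mxE eqxx subr0 expr1n.
  by move=> j ji; rewrite !mxE (negbTE ji) subrr expr0n.
have e1' : fronorm (e - 0) = 1.
  by apply: (pexpIrn (n := 2)); rewrite ?nnegrE ?fronorm_ge0 // e1 expr1n.
have := monF e 0; rewrite e1 mulr1 => /le_trans; apply.
rewrite /inner (bigD1 i) //= big1 ?addr0.
  rewrite !mxE eqxx subr0 mulr1; apply: le_trans (ler_norm _) _.
  by apply: le_trans (lip _ _ _) _; rewrite e1' mulr1.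
by move=> j ji; rewrite !mxE (negbTE ji) subrr mulr0.
Qed.

End Nash.

(** * Distributed gradient play *)

Section Dynamics.
Variables (R : realType) (n : nat).
Hypothesis n2 : (2 <= n)%N.
Local Notation N := (n%:R : R).
Implicit Types (X : 'M[R]_n) (x : 'rV[R]_n).

Let N2 : 2 <= N. Proof. by rewrite (ler_nat _ 2). Qed.
Let N0 : N != 0. Proof. by rewrite lt0r_neq0 // (lt_le_trans _ N2). Qed.

(** * Mean and deviation of an estimation matrix *)

Definition row_mean X : 'rV[R]_n := \row_j (N^-1 * \sum_i X i j).
Definition deviation X : 'M[R]_n := X - consensus (row_mean X).
(** The factor [N] counts the equal rows of a consensus matrix. *)
Definition mean_error x X : R := N * \sum_j (row_mean X 0 j - x 0 j) ^+ 2.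
Definition consensus_error X : R := \sum_i \sum_j deviation X i j ^+ 2.

Lemma mean_error_ge0 x X : 0 <= mean_error x X.
Proof. by rewrite mulr_ge0 // sumr_ge0 // => j _; rewrite sqr_ge0. Qed.

Lemma consensus_error_ge0 X : 0 <= consensus_error X.
Proof.
by rewrite sumr_ge0 // => i _; rewrite sumr_ge0 // => j _; rewrite sqr_ge0.
Qed.

Lemma deviationE X i j : deviation X i j = X i j - row_mean X 0 j.
Proof. by rewrite !mxE. Qed.

Lemma deviation_col_sum X j : \sum_i deviation X i j = 0.
Proof.
rewrite (eq_bigr (fun i => X i j - row_mean X 0 j)); last first.
  by move=> i _; rewrite !mxE.
rewrite sumrB sumr_const card_ord mxE -[_ *+ n]mulr_natl mulVKf ?subrr //.
Qed.

(** Pythagoras: the cross term vanishes because the columns of the deviation sum to 0. *)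
Lemma fronorm_consensus_split x X :
  fronorm (X - consensus x) ^+ 2 = mean_error x X + consensus_error X.
Proof.
rewrite fronorm_sqr /mean_error /consensus_error mulr_sumr.
rewrite exchange_big [in RHS]exchange_big /= -big_split /=.
apply: eq_bigr => j _; set d := row_mean X 0 j - x 0 j.
transitivity (\sum_i (d ^+ 2 + 2 * d * deviation X i j + deviation X i j ^+ 2)).
  by apply: eq_bigr => i _; rewrite /deviation /d !mxE; ring.
rewrite big_split /= big_split /= -[X in _ + X + _]mulr_sumr deviation_col_sum mulr0 addr0.
by rewrite sumr_const card_ord mulr_natl.
Qed.

(** Column [j] has one entry [g j * (1 - 1 / N)] and [N - 1] entries [- g j / N]. This is the origin
    of [(n - 1) / n] in the step size bound. *)
Lemma sum_centered_diag_sqr (g : 'I_n -> R) :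
  \sum_i \sum_j (g i *+ (i == j) - g j / N) ^+ 2 =
  (1 - N^-1) * \sum_j g j ^+ 2.
Proof.
rewrite exchange_big mulr_sumr /=; apply: eq_bigr => j _.
transitivity (\sum_i ((if i == j then g j ^+ 2 * (1 - 2 / N) else 0)
                       + (g j / N) ^+ 2)).
  apply: eq_bigr => i _; have [->|_] := eqVneq i j.
    by rewrite mulr1n; field.
  by rewrite mulr0n; ring.
rewrite big_split /= -big_mkcond /= big_pred1_eq sumr_const card_ord -mulr_natl.
by field.
Qed.

(** * One step of the dynamics *)

Variables (J : 'I_n -> 'rV[R]_n -> R) (W : 'M[R]_n) (Li : 'I_n -> R).
Variables (mu L sigma alpha : R) (xs : 'rV[R]_n).
Hypothesis mu0 : 0 < mu.
Hypothesis muL : mu <= L.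
Hypothesis monF : strongly_monotone (game_mapping J) mu.
Hypothesis LiL : forall i, Li i <= L.
Hypothesis lipJ :
  forall i x y, `|partial J i x - partial J i y| <= Li i * fronorm (x - y).
Hypothesis dsW : doubly_stochastic W.
Hypothesis svW : second_singular_value W sigma.
Hypothesis sigma01 : 0 < sigma < 1.
Hypothesis alpha_bound : 0 < alpha < step_bound n mu L sigma.
Hypothesis Fxs : game_mapping J xs = 0.

Let L0 : 0 < L. Proof. exact: lt_le_trans muL. Qed.
Let a0 : 0 < alpha. Proof. by case/andP: alpha_bound. Qed.

Let step X := W *m X - alpha *: Ftilde J X.
(** The gradients [g] that the players use split into [f], taken at the common mean and governed by
    strong monotonicity, and the error [h] caused by disagreement. *)
Let g X i := partial J i (row i X).
Let f X i := partial J i (row_mean X).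
Let h X i := g X i - f X i.

Lemma partial_lipschitz_sqr i x y :
  (partial J i x - partial J i y) ^+ 2 <= L ^+ 2 * fronorm (x - y) ^+ 2.
Proof.
rewrite -exprMn -real_normK ?num_real // ler_pXn2r ?nnegrE //.
- by apply: le_trans (lipJ _ _ _) _; rewrite ler_wpM2r ?fronorm_ge0.
- by rewrite mulr_ge0 ?fronorm_ge0 // ltW.
Qed.

Let sum_h X : \sum_i h X i ^+ 2 <= L ^+ 2 * consensus_error X.
Proof.
rewrite mulr_sumr; apply: ler_sum => i _.
apply: le_trans (partial_lipschitz_sqr _ _ _) _.
rewrite fronorm_row ler_wpM2l ?sqr_ge0 //.
by apply: ler_sum => j _; rewrite !mxE.
Qed.

Let sum_f X : \sum_i f X i ^+ 2 <= L ^+ 2 * mean_error xs X.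
Proof.
have -> : L ^+ 2 * mean_error xs X =
    \sum_(i < n) L ^+ 2 * fronorm (row_mean X - xs) ^+ 2.
  rewrite sumr_const card_ord -mulr_natl fronorm_row mulrCA /mean_error.
  by congr (_ * (_ * _)); apply: eq_bigr => j _; rewrite !mxE.
apply: ler_sum => i _; have := partial_lipschitz_sqr i (row_mean X) xs.
by have /rowP/(_ i) := Fxs; rewrite !mxE => ->; rewrite subr0.
Qed.

Let inner_f X :
  mu * mean_error xs X <= N * \sum_j f X j * (row_mean X 0 j - xs 0 j).
Proof.
have := monF (row_mean X) xs; rewrite Fxs subr0 fronorm_row /inner => h1.
rewrite /mean_error mulrCA ler_wpM2l //.
apply: le_trans (_ : mu * (\sum_j (row_mean X - xs) 0 j ^+ 2) <= _).
  by rewrite ler_wpM2l ?(ltW mu0) //; apply: ler_sum => j _; rewrite !mxE.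
by apply: (le_trans h1); apply: ler_sum => j _; rewrite !mxE.
Qed.

Let stepE X i j : step X i j = (W *m X) i j - alpha * (g X i *+ (i == j)).
Proof. by rewrite !mxE. Qed.

(** Mixing preserves the row mean, as the columns of [W] sum to 1. *)
Let row_mean_step X j :
  row_mean (step X) 0 j = row_mean X 0 j - alpha / N * g X j.
Proof.
have [_ _ W1] := dsW; rewrite !mxE.
rewrite (eq_bigr (fun i => \sum_k W i k * X k j - alpha * (g X i *+ (i == j)))).
  rewrite sumrB exchange_big /= -mulr_sumr mulrBr; congr (_ - _).
    congr (_ * _); apply: eq_bigr => k _.
    by rewrite -mulr_suml W1 mul1r.
  rewrite (eq_bigr (fun i => if i == j then g X j else 0)).
    by rewrite -big_mkcond /= big_pred1_eq; field.
  by move=> i _; case: eqP => [->|_]; rewrite ?mulr1n ?mulr0n.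
by move=> i _; rewrite !mxE.
Qed.

(** [W] fixes consensus matrices, as its rows sum to 1. *)
Let deviation_step X i j : deviation (step X) i j =
  (W *m deviation X) i j - alpha * (g X i *+ (i == j) - g X j / N).
Proof.
have [_ W1 _] := dsW.
rewrite deviationE row_mean_step stepE.
have -> : (W *m deviation X) i j = (W *m X) i j - row_mean X 0 j.
  rewrite [LHS]mxE [in RHS]mxE -[row_mean X 0 j]mul1r -(W1 i) mulr_suml -sumrB.
  by apply: eq_bigr => l _; rewrite deviationE mulrBr.
by field.
Qed.

Let bounds := step_bound_consequences n2 mu0 L0 sigma01 alpha_bound.

(** Strong monotonicity yields a decrease [2 alpha mu / N] times the mean error. A quarter of it
    pays for the cross term with [h], half for the term quadratic in [alpha], and a quarter
    remains. *)
Lemma mean_error_step X : mean_error xs (step X) <=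
  (1 - alpha * mu / (2 * N)) * mean_error xs X
  + 5 * alpha * L ^+ 2 / (2 * mu) * consensus_error X.
Proof.
have [_ aL _ _] := bounds.
have Np : 0 < N by rewrite (lt_le_trans _ N2).
have munz : mu != 0 by rewrite gt_eqF.
set D := mean_error xs X; set S := consensus_error X.
have D0 : 0 <= D by exact: mean_error_ge0.
have S0 : 0 <= S by exact: consensus_error_ge0.
pose d j := row_mean X 0 j - xs 0 j.
(* Coordinatewise, Young's inequality for the cross term with [h] and
   [(u + v) ^+ 2 <= 2 (u ^+ 2 + v ^+ 2)]. *)
have main : mean_error xs (step X) <=
   D - 2 * alpha * (\sum_j f X j * d j) + alpha * mu / (2 * N) * D
   + 2 * alpha / mu * (\sum_j h X j ^+ 2)
   + 2 * alpha ^+ 2 / N * (\sum_j f X j ^+ 2 + \sum_j h X j ^+ 2).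
  have -> : alpha * mu / (2 * N) * D = \sum_j alpha * mu / 2 * d j ^+ 2.
    by rewrite -mulr_sumr /D /mean_error; field.
  rewrite /mean_error /D /mean_error -big_split /= !mulr_sumr -sumrB.
  rewrite -!big_split /=; apply: ler_sum => j _.
  rewrite row_mean_step -/(d j).
  have -> : row_mean X 0 j - alpha / N * g X j - xs 0 j =
     d j - alpha / N * (f X j + h X j) by rewrite /h /d; ring.
  rewrite -subr_ge0.
  set u := f X j; set v := h X j; set w := d j.
  have -> : N * w ^+ 2 - 2 * alpha * (u * w) + alpha * mu / 2 * w ^+ 2 +
   2 * alpha / mu * v ^+ 2 + 2 * alpha ^+ 2 / N * (u ^+ 2 + v ^+ 2) -
   N * (w - alpha / N * (u + v)) ^+ 2 =
   alpha / (2 * mu) * (mu * w + 2 * v) ^+ 2 + alpha ^+ 2 / N * (u - v) ^+ 2.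
    by field; rewrite munz N0.
  by rewrite addr_ge0 // mulr_ge0 ?sqr_ge0 // divr_ge0 ?sqr_ge0 ?mulr_ge0 // ltW.
apply: (le_trans main).
have inn : mu / N * D <= \sum_j f X j * d j.
  by rewrite [mu / N * D]mulrAC ler_pdivrMr // [leRHS]mulrC; exact: inner_f.
have hS := sum_h X; rewrite -/S in hS.
have fD := sum_f X; rewrite -/D in fD.
have c1 : 0 <= 2 * alpha / mu.
  by rewrite divr_ge0 ?(ltW mu0) // mulr_ge0 // ltW.
have c2 : 0 <= 2 * alpha ^+ 2 / N.
  by rewrite divr_ge0 ?ler0n // mulr_ge0 // sqr_ge0.
have c3 : 0 <= 2 * alpha by rewrite mulr_ge0 // ltW.
have t1 := ler_wpM2l c3 inn.
have t2 := ler_wpM2l c1 hS.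
have t3 := ler_wpM2l c2 (lerD fD hS).
have t4 : 2 * alpha ^+ 2 / N * (L ^+ 2 * D + L ^+ 2 * S) <= alpha * mu / N * (D + S).
  have -> : 2 * alpha ^+ 2 / N * (L ^+ 2 * D + L ^+ 2 * S) =
    alpha / N * (D + S) * (2 * (alpha * L ^+ 2)) by ring.
  have -> : alpha * mu / N * (D + S) = alpha / N * (D + S) * mu by ring.
  rewrite ler_wpM2l //; last lra.
  by rewrite mulr_ge0 ?addr_ge0 // divr_ge0 // ltW.
have t5 : alpha * mu / N * S <= alpha * L ^+ 2 / (2 * mu) * S.
  rewrite ler_wpM2r // ler_pdivrMr //.
  have -> : alpha * L ^+ 2 / (2 * mu) * N = alpha * (L ^+ 2 * N / (2 * mu)) by ring.
  rewrite ler_wpM2l ?(ltW a0) // ler_pdivlMr ?mulr_gt0 //.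
  have : mu ^+ 2 <= L ^+ 2 by rewrite ler_pXn2r ?nnegrE // ltW.
  have : L ^+ 2 * 2 <= L ^+ 2 * N by rewrite ler_wpM2l ?sqr_ge0.
  lra.
have e1 : alpha * mu / (2 * N) * D = alpha * mu / N * D / 2 by field.
have e2 : 5 * alpha * L ^+ 2 / (2 * mu) * S = 5 * (alpha * L ^+ 2 / (2 * mu) * S) by field.
have e3 : 2 * alpha / mu * (L ^+ 2 * S) = 4 * (alpha * L ^+ 2 / (2 * mu) * S) by field.
have e4 : 2 * alpha * (mu / N * D) = 2 * (alpha * mu / N * D) by ring.
rewrite mulrBl mul1r e1 e2.
move: t1 t2 t3 t4 t5; rewrite e3 e4 mulrDr.
lra.
Qed.

Let k := alpha * L * (Num.sqrt (N - 1) / Num.sqrt N).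

Let kbounds : [/\ 0 < k, sigma + k < 1 &
   5 * N * k ^+ 2 * L ^+ 2 < mu ^+ 2 * (1 - (sigma + k)) ^+ 2].
Proof.
have [_ _ h1 h2] := bounds.
by apply: (coupling_lt (alpha := alpha)) => //; rewrite mu0.
Qed.

(** The new deviation is a sum of three matrices of norm at most [sigma sqrt S], [k sqrt S] and
    [k sqrt D]. Convexity with weights [sigma], [k] and [1 - sigma - k] turns the first two into
    [(sigma + k) S]. *)
Lemma consensus_error_step X : consensus_error (step X) <=
  k ^+ 2 / (1 - (sigma + k)) * mean_error xs X + (sigma + k) * consensus_error X.
Proof.
have [k0 sk1 _] := kbounds; case/andP: sigma01 => s0 s1.
set D := mean_error xs X; set S := consensus_error X.
have w0 : 0 < 1 - (sigma + k) by lra.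
have k2 : k ^+ 2 = alpha ^+ 2 * L ^+ 2 * (1 - N^-1).
  rewrite /k !exprMn exprVn !sqr_sqrtr ?subr_ge0 //; first by field.
  by rewrite (le_trans _ N2) // ler1n.
pose cd (u : 'I_n -> R) i j := u i *+ (i == j) - u j / N.
have : consensus_error (step X) <=
    (\sum_i \sum_j (W *m deviation X) i j ^+ 2) / sigma
    + alpha ^+ 2 * (\sum_i \sum_j cd (h X) i j ^+ 2) / k
    + alpha ^+ 2 * (\sum_i \sum_j cd (f X) i j ^+ 2) / (1 - (sigma + k)).
  rewrite !mulr_sumr !mulr_suml -!big_split /=; apply: ler_sum => i _.
  rewrite !mulr_sumr !mulr_suml -!big_split /=; apply: ler_sum => j _.
  rewrite deviation_step -!exprMn -[(alpha * cd (h X) i j) ^+ 2]sqrrN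
    -[(alpha * cd (f X) i j) ^+ 2]sqrrN.
  have -> : (W *m deviation X) i j - alpha * (g X i *+ (i == j) - g X j / N) =
    (W *m deviation X) i j + - (alpha * cd (h X) i j) + - (alpha * cd (f X) i j).
    by rewrite /cd /h mulrnBl; ring.
  by apply: sqr_sum3_le => //; ring.
move=> /le_trans; apply.
rewrite !sum_centered_diag_sqr.
(* The spectral gap applies to each column of the deviation, whose sum is 0. *)
have tW : (\sum_i \sum_j (W *m deviation X) i j ^+ 2) / sigma <= sigma * S.
  rewrite ler_pdivrMr // mulrAC -expr2 /S /consensus_error.
  rewrite exchange_big [in leRHS]exchange_big /= mulr_sumr.
  apply: ler_sum => j _.
  have := second_singular_value_contraction dsW svW _ (v := col j (deviation X)).
  rewrite ltW // s1 => /(_ isT).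
  have -> : \sum_i col j (deviation X) i 0 = 0.
    by rewrite -[RHS](deviation_col_sum X j); apply: eq_bigr => i _; rewrite mxE.
  move=> /(_ erefl); congr (_ <= _ * _).
    apply: eq_bigr => i _; rewrite [in LHS]mxE [in RHS]mxE; congr (_ ^+ 2).
    by apply: eq_bigr => l _; rewrite [col _ _ _ _]mxE.
  by apply: eq_bigr => i _; rewrite mxE.
have a2 : 0 <= alpha ^+ 2 * (1 - N^-1).
  by rewrite -(pmulr_lge0 _ (exprn_gt0 2 L0)) mulrAC -k2 sqr_ge0.
have th : alpha ^+ 2 * ((1 - N^-1) * (\sum_j h X j ^+ 2)) / k <= k * S.
  rewrite ler_pdivrMr // [leRHS]mulrAC -expr2 k2 mulrA.
  apply: le_trans (ler_wpM2l a2 (sum_h X)) _; rewrite -/S.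
  by rewrite [leLHS](_ : _ = alpha ^+ 2 * L ^+ 2 * (1 - N^-1) * S) //; ring.
have tf : alpha ^+ 2 * ((1 - N^-1) * (\sum_j f X j ^+ 2)) / (1 - (sigma + k)) <=
   k ^+ 2 / (1 - (sigma + k)) * D.
  rewrite [leRHS]mulrAC ler_wpM2r ?invr_ge0 ?(ltW w0) // k2 mulrA.
  apply: le_trans (ler_wpM2l a2 (sum_f X)) _; rewrite -/D.
  by rewrite [leLHS](_ : _ = alpha ^+ 2 * L ^+ 2 * (1 - N^-1) * D) //; ring.
lra.
Qed.

Lemma gradient_play_geometric : exists2 q : R, 0 < q < 1 &
  forall X0 : 'M[R]_n, exists C : R, forall t : nat,
    fronorm (gradient_play J W alpha X0 t - consensus xs) ^+ 2 <= C * q ^+ t.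
Proof.
have [k0 sk1 kL] := kbounds; have [a1 aL _ _] := bounds.
case/andP: sigma01 => s0 s1.
set s := sigma + k in kL sk1.
have w0 : 0 < 1 - s by lra.
have Np : 0 < N by rewrite (lt_le_trans _ N2).
have amu : alpha * mu <= 1 / 2.
  have : alpha * mu ^+ 2 <= alpha * L ^+ 2.
    by rewrite ler_wpM2l ?(ltW a0) // ler_pXn2r ?nnegrE // ltW.
  move=> h1; rewrite -(ler_pM2r mu0); lra.
have [|||||theta [q [th0 q01 qD qS]]] := @lyapunov_weight R
    (alpha * mu / (2 * N)) (5 * alpha * L ^+ 2 / (2 * mu)) (k ^+ 2 / (1 - s)) s.
- rewrite divr_gt0 ?mulr_gt0 //= ltr_pdivrMr ?mulr_gt0 //; have := N2; lra.
- by rewrite divr_gt0 ?mulr_gt0 ?exprn_gt0.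
- by rewrite divr_gt0 ?exprn_gt0.
- by rewrite sk1 addr_gt0.
(* With a common positive factor pulled out, the condition becomes the last inequality of
   [kbounds]. *)
- have -> : 5 * alpha * L ^+ 2 / (2 * mu) * (k ^+ 2 / (1 - s)) =
     alpha / (2 * mu * N * (1 - s)) * (5 * N * k ^+ 2 * L ^+ 2).
    by field; rewrite N0 !gt_eqF.
  have -> : alpha * mu / (2 * N) * (1 - s) =
     alpha / (2 * mu * N * (1 - s)) * (mu ^+ 2 * (1 - s) ^+ 2).
    by field; rewrite N0 !gt_eqF.
  by rewrite ltr_pM2l // divr_gt0 ?mulr_gt0.
exists q => // X0.
pose V X := mean_error xs X + theta * consensus_error X.
have Vstep X : V (step X) <= q * V X.
  have D0 := mean_error_ge0 xs X; have S0 := consensus_error_ge0 X.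
  have hD := mean_error_step X; have hS := ler_wpM2l (ltW th0) (consensus_error_step X).
  have := ler_wpM2r D0 qD; have := ler_wpM2r S0 qS.
  by move: hD hS; rewrite /V -/s; lra.
have Vt t : V (gradient_play J W alpha X0 t) <= q ^+ t * V X0.
  elim: t => [|t IH]; first by rewrite expr0 mul1r.
  rewrite /gradient_play iterS exprS -mulrA; apply: le_trans (Vstep _) _.
  by rewrite ler_pM2l //; case/andP: q01.
(* The factor [1 + theta^-1] lets [V] dominate the unweighted sum of both errors. *)
exists ((1 + theta^-1) * V X0) => t.
rewrite fronorm_consensus_split -mulrA (mulrC (V X0)).
apply: le_trans (_ : (1 + theta^-1) * V (gradient_play J W alpha X0 t) <= _).
  set X := gradient_play _ _ _ _ _.
  have D0 := mean_error_ge0 xs X; have S0 := consensus_error_ge0 X.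
  have -> : (1 + theta^-1) * V X = mean_error xs X + consensus_error X +
     (mean_error xs X / theta + theta * consensus_error X).
    by rewrite /V; field; rewrite gt_eqF.
  by rewrite lerDl addr_ge0 // mulr_ge0 // ?invr_ge0 ltW.
by rewrite ler_wpM2l ?Vt // addr_ge0 // invr_ge0 ltW.
Qed.

End Dynamics.

(** The topology on matrices is that of the sup norm, which the Frobenius norm dominates. *)
Lemma cvg_geometric_fronorm (R : realType) n (X : nat -> 'M[R]_n) Y (C q : R) :
  0 < q < 1 -> (forall t, fronorm (X t - Y) ^+ 2 <= C * q ^+ t) ->
  X @ \oo --> Y.
Proof.
move=> /andP[q0 q1] XC; apply/cvgrPdist_le => e e0.
have : geometric C q @ \oo --> (0 : R) by apply: cvg_geometric; rewrite gtr0_norm.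
move=> /cvgrPdist_le/(_ (e ^+ 2) (exprn_gt0 2 e0)).
apply: filterS => t /=; rewrite sub0r normrN => h.
rewrite distrC -(@ler_pXn2r _ 2 isT) ?nnegrE ?(ltW e0) //.
apply: le_trans (_ : fronorm (X t - Y) ^+ 2 <= _).
  by rewrite ler_pXn2r ?nnegrE ?fronorm_ge0 // norm_le_fronorm.
by rewrite (le_trans (XC t)) // (le_trans (ler_norm _)).
Qed.

Theorem theorem1 (R : realType) (n : nat) (J : 'I_n -> 'rV[R]_n -> R)
    (A : rel 'I_n) (W : 'M[R]_n) (mu : R) (Li : 'I_n -> R) (sigma alpha : R) :
  let L := \big[Num.max/0]_(i < n) Li i in
  (2 <= n)%N ->
  C1_own_action J ->
  0 < mu ->
  strongly_monotone (game_mapping J) mu ->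
  (forall i, 0 <= Li i) ->
  (forall i x y, `|partial J i x - partial J i y| <= Li i * fronorm (x - y)) ->
  symmetric A ->
  connected_graph A ->
  doubly_stochastic W ->
  (forall i j, (0 < W i j) <-> A i j) ->
  second_singular_value W sigma ->
  0 < sigma < 1 ->
  0 < alpha < step_bound n mu L sigma ->
  exists xstar : 'rV[R]_n,
    [/\ unique (nash_equilibrium J) xstar,
        forall X0 : 'M[R]_n,
          gradient_play J W alpha X0 @ \oo --> consensus xstar &
        exists2 q : R, 0 < q < 1 &
          forall X0 : 'M[R]_n, exists C : R, forall t : nat,
            fronorm (gradient_play J W alpha X0 t - consensus xstar) ^+ 2
              <= C * q ^+ t].
Proof.
move=> L n2 C1 mu0 monF Li0 lipJ _ _ dsW _ svW sigma01 alpha_bound.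
have LiL i : Li i <= L by exact: le_bigmax.
have muL : mu <= L.
  apply: le_trans (LiL (Ordinal (ltnW n2))).
  exact: strongly_monotone_le_lipschitz monF lipJ.
(* Summing the bounds of the [n] coordinates gives the squared Lipschitz constant
   [n%:R * L ^+ 2]. *)
have [xs Fxs] : exists x, game_mapping J x = 0.
  apply: (@strongly_monotone_zero _ _ _ mu (n%:R * L ^+ 2)) => // [|x y].
    by rewrite mulr_ge0 ?sqr_ge0.
  rewrite fronorm_row -mulrA.
  have -> : n%:R * (L ^+ 2 * fronorm (x - y) ^+ 2) =
      \sum_(i < n) L ^+ 2 * fronorm (x - y) ^+ 2.
    by rewrite sumr_const card_ord mulr_natl.
  apply: ler_sum => i _; rewrite !mxE.
  exact: (partial_lipschitz_sqr mu0 muL LiL lipJ).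
have [q q01 geo] := gradient_play_geometric n2 mu0 muL monF LiL lipJ dsW svW
  sigma01 alpha_bound Fxs.
exists xs; split.
- split; first exact: (game_mapping0_nash C1 (ltW mu0) monF Fxs).
  move=> x nash_x; apply: (strongly_monotone_zero_inj mu0 monF Fxs).
  exact: nash_game_mapping0.
- by move=> X0; have [C XC] := geo X0; exact: cvg_geometric_fronorm q01 XC.
- by exists q.
Qed.
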